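(* Let $f$ be a function on isomorphism classes of binary delta-matroids with values in a complex vector space, satisfying the four-term relation $$f(D)-f(D'_{ab})=f(\widetilde D_{ab})-f\big((\widetilde D_{ab})'_{ab}\big)$$ for every binary delta-matroid $D=(E;\Phi)$ and every pair of distinct $a,b\in E$. Then the function $g(\Gamma)=f(D(\Gamma))$ on embedded graphs satisfies the four-term relation for embedded graphs, i.e. is a weight system: for every embedded graph $\Gamma$ and every pair of distinct edges $a,b$ of $\Gamma$ having neighboring ends at some vertex, $$g(\Gamma)-g(\Gamma'_{ab})=g(\widetilde\Gamma_{ab})-g\big((\widetilde\Gamma_{ab})'_{ab}\big).$$
   Context: Set system $(E;\Phi)$: finite $E$, nonempty $\Phi\subseteq2^E$, up to isomorphism. Twist $D*E'=(E;\{\phi\Delta E'\})$. A binary delta-matroid is a set system isomorphic to a twist of the nondegeneracy delta-matroid of a framed graph (simple graph with framing $V\to\{0,1\}$, $\mathbb{F}_2$-adjacency matrix with the framing on the diagonal; feasible sets are vertex subsets with nondegenerate induced adjacency matrix over $\mathbb{F}_2$, including $\emptyset$). Sliding: $\widetilde D_{ab}=(E;\Phi\,\Delta\,\{\phi\sqcup\{a\}\mid\phi\subseteq E\setminus\{a,b\},\ \phi\sqcup\{b\}\in\Phi\})$; exchange: $D'_{ab}=\big(\widetilde{(D*\{b\})}_{ab}\big)*\{b\}$. An embedded graph is a connected graph cellularly embedded in a compact (possibly nonorientable) surface; its delta-matroid $D(\Gamma)$ has ground set the edge set, with $\phi$ feasible iff the spanning ribbon subgraph with edge set $\phi$ has connected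 boundary; $D(\Gamma)$ is binary. For edges $a\ne b$ having neighboring ends at a vertex, $\Gamma'_{ab}$ is obtained by exchanging these two neighboring ends (first Vassiliev move), and $\widetilde\Gamma_{ab}$ is obtained by sliding the end of $a$ neighboring $b$ along the ribbon $b$ to the other end of $b$ (handle sliding, second Vassiliev move). *)

(* Defs.v *)
From HB Require Import structures.
From mathcomp Require Import all_boot all_order all_algebra.
From mathcomp Require Import complex.
From mathcomp Require Import reals.
Set Implicit Arguments. Unset Strict Implicit. Unset Printing Implicit Defensive.
Import GRing.Theory.

Definition symd (T : finType) (A B : {set T}) : {set T} := (A :\: B) :|: (B :\: A).

Definition iso_ss (E E' : finType) (Phi : {set {set E}}) (Psi : {set {set E'}}) : Prop :=
  exists h : E -> E', bijective h /\ Psi = [set h @: S | S : {set E} in Phi].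

Definition twist (E : finType) (Phi : {set {set E}}) (X : {set E}) : {set {set E}} :=
  [set symd S X | S : {set E} in Phi].

Definition slide_ss (E : finType) (a b : E) (Phi : {set {set E}}) : {set {set E}} :=
  symd Phi [set S :|: [set a] | S : {set E} &
              [&& a \notin S, b \notin S & (S :|: [set b]) \in Phi]].

Definition exch_ss (E : finType) (a b : E) (Phi : {set {set E}}) : {set {set E}} :=
  twist (slide_ss a b (twist Phi [set b])) [set b].

Record framed_graph (V : finType) := FramedGraph {
  fg_adj : rel V;
  fg_sym : symmetric fg_adj;
  fg_irr : irreflexive fg_adj;
  fg_frame : V -> bool }.

Definition fg_entry (V : finType) (G : framed_graph V) (u v : V) : 'F_2 :=
  if u == v then ((fg_frame G u)%:R)%R else ((fg_adj G u v)%:R)%R.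

Definition induced_mx (V : finType) (G : framed_graph V) (S : {set V}) : 'M['F_2]_#|S| :=
  \matrix_(i < #|S|, j < #|S|) fg_entry G (enum_val i) (enum_val j).

Definition nondeg (V : finType) (G : framed_graph V) : {set {set V}} :=
  [set S : {set V} | (\det (induced_mx G S) != 0)%R].

Definition binary_dm (E : finType) (Phi : {set {set E}}) : Prop :=
  exists (V : finType) (G : framed_graph V) (X : {set V}),
    iso_ss Phi (twist (nondeg G) X).

(* An embedded graph with edge set E is encoded by its flags (e, h, s):
   e an edge, h in bool one of its two ends, s in bool one of its two sides.
   t0 changes the end (moves along a side of the ribbon e), t2 changes the
   side (at the same end), t1 is a fixed-point-free involution pairing the
   flags forming a corner at a vertex.  Vertices = <t1,t2>-orbits,
   edges = <t0,t2>-orbits, faces = <t0,t1>-orbits. *)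

Definition flag (E : finType) := (E * bool * bool)%type.
Definition fedge (E : finType) (x : flag E) : E := x.1.1.
Definition ft0 (E : finType) (x : flag E) : flag E := (x.1.1, ~~ x.1.2, x.2).
Definition ft2 (E : finType) (x : flag E) : flag E := (x.1.1, x.1.2, ~~ x.2).

Definition is_embedded_graph (E : finType) (t1 : flag E -> flag E) : Prop :=
  [/\ involutive t1, (forall x, t1 x != x) &
      forall x y : flag E,
        connect (fun u v => [|| v == ft0 u, v == t1 u | v == ft2 u]) x y].

(* boundary walk relation of the spanning ribbon subgraph with edge set S:
   along a kept edge one moves with t0, across a deleted edge with t2 *)
Definition bdry_rel (E : finType) (t1 : flag E -> flag E) (S : {set E}) : rel (flag E) :=
  fun u v => (v == (if fedge u \in S then ft0 u else ft2 u)) || (v == t1 u).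

(* D(Gamma): feasible sets = edge sets of spanning subgraphs with connected boundary *)
Definition dm_of (E : finType) (t1 : flag E -> flag E) : {set {set E}} :=
  [set S : {set E} | [forall x, forall y, connect (bdry_rel t1 S) x y]].

(* First Vassiliev move: exchange the neighboring ends of a = fedge x and
   b = fedge (t1 x) meeting at the corner {x, t1 x}. *)
Definition exch_eg (E : finType) (t1 : flag E -> flag E) (x : flag E) : flag E -> flag E :=
  let y := t1 x in let xb := ft2 x in let yb := ft2 y in
  let p := t1 xb in let q := t1 yb in
  if p == yb then t1 else
  fun u => if u == p then y else if u == y then p else
           if u == yb then xb else if u == xb then yb else
           if u == x then q else if u == q then x else t1 u.

(* Second Vassiliev move: slide the end of a (containing x) neighboring b
   along the ribbon b (along the side of b facing it) to the other end of b. *)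
Definition slide_eg (E : finType) (t1 : flag E -> flag E) (x : flag E) : flag E -> flag E :=
  let y := t1 x in let xb := ft2 x in
  let p := t1 xb in let z := ft0 y in let r := t1 z in
  if p == z then t1 else
  fun u => if u == p then y else if u == y then p else
           if u == z then xb else if u == xb then z else
           if u == x then r else if u == r then x else t1 u.

(* Main.v *)
Require Import Defs.
From HB Require Import structures.
From mathcomp Require Import all_boot all_order all_algebra.
From mathcomp Require Import complex.
From mathcomp Require Import reals.
Import GRing.Theory.
Local Open Scope ring_scope.

(* Over F_2 (here bool, whose field structure has xor as addition), a ribbon graph
   has the Lagrangian L of jump vectors of the functions on its flags that are
   constant on corners and sum to zero on every edge: each edge contributes the
   jump along it and the jump across it. A set S of edges is feasible iff no
   nonzero vector of L vanishes in the coordinates selected by S, one at each edge.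
   Both Vassiliev moves act on L by a symplectic transformation involving only the
   edges a and b. Once every other coordinate is selected, L leaves a Lagrangian
   plane in the 4-dimensional space at a and b, where the effect of the transformation
   on feasibility is a finite check; it is that of slide_ss and exch_ss. If S0 is
   feasible, L is the graph of a symmetric matrix over the coordinates of S0,
   which makes the delta-matroid binary. *)

(** * Lagrangians over F_2 and their delta-matroids *)

Section Lagrangian.
Variable E : finType.
Implicit Types (S A : {set E}) (L : {set {ffun E * bool -> bool}}).
Implicit Types (v w : {ffun E * bool -> bool}) (a b e : E).

(* At each edge, (e, false) and (e, true) are dual coordinates for symp; S selects
   the former when e is in S and the latter otherwise. *)
Definition sel S v e : bool := v (e, e \notin S).

Definition sel_ker L S := [set v in L | [forall e, sel S v e == 0]].

Definition dm_lag L : {set {set E}} := [set S | [forall v in sel_ker L S, v == 0]].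

Definition symp v w : bool :=
  \sum_e (v (e, false) * w (e, true) + v (e, true) * w (e, false)).

(* Maximality of L is replaced by lag_full, the only form in which it is used. *)
Record lagrangian L : Prop := Lagrangian {
  lag0 : 0 \in L;
  lagD : forall v w, v \in L -> w \in L -> v + w \in L;
  lag_symp : forall v w, v \in L -> w \in L -> symp v w = 0;
  lag_full : forall S e, S \in dm_lag L ->
    exists2 v, v \in L & forall f, sel S v f = (f == e) }.

Lemma mem_symd S A e : (e \in symd S A) = (e \in S) (+) (e \in A).
Proof. by rewrite !inE; do 2 case: (_ \in _). Qed.

Lemma sel_kerP L S v :
  reflect (v \in L /\ forall e, sel S v e = 0) (v \in sel_ker L S).
Proof.
rewrite inE; apply: (iffP andP) => [] [vL].
  by move/forallP => H; split=> // e; apply/eqP.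
by move=> H; split=> //; apply/forallP => e; rewrite H.
Qed.

Lemma dm_lagP L S :
  reflect (forall v, v \in L -> (forall e, sel S v e = 0) -> v = 0) (S \in dm_lag L).
Proof.
rewrite inE; apply: (iffP forall_inP) => [H v vL v0 | H v /sel_kerP [vL v0]].
  by apply/eqP/H/sel_kerP.
by apply/eqP/H.
Qed.

Lemma symp_sel S v w :
  symp v w = \sum_e (sel S v e * w (e, e \in S) + v (e, e \in S) * sel S w e).
Proof.
apply: eq_bigr => e _; rewrite /sel.
by case: (e \in S) => //=; rewrite addrC.
Qed.

(* Choose S0 with the fewest vectors in its kernel: if some v in the kernel were
   nonzero at e in A, then by isotropy replacing S0 with symd S0 [set e] would
   shrink the kernel. *)
Lemma exists_reduced L A S : lagrangian L ->
  exists2 S0 : {set E}, S0 :\: A = S :\: A &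
    forall v, v \in sel_ker L S0 -> forall e i, e \in A -> v (e, i) = 0.
Proof.
move=> lagL.
case: (@arg_minnP _ S (fun S0 : {set E} => S0 :\: A == S :\: A)
        (fun S0 => #|sel_ker L S0|) (eqxx _)) => S0 /eqP eS0 minS0.
exists S0 => // v vk e i eA.
have /sel_kerP [vL v0] := vk.
have [->|ne] := eqVneq i (e \notin S0); first exact: v0.
have {i ne} -> : i = (e \in S0) by move: ne; case: i; case: (e \in S0).
apply/eqP; apply: contraT => ve.
pose S1 := symd S0 [set e].
have S1E f : f != e -> (f \in S1) = (f \in S0).
  by move=> /negPf fe; rewrite mem_symd inE fe addbF.
have eS1 : (e \in S1) = (e \notin S0) by rewrite mem_symd inE eqxx addbT.
have: (#|sel_ker L S0| <= #|sel_ker L S1|)%N.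
  apply: minS0; rewrite -eS0; apply/eqP/setP => f; rewrite !in_setD.
  by have [->|/S1E ->] := eqVneq f e; rewrite ?eA.
rewrite leqNgt => /negP [].
apply: proper_card; apply/properP; split.
  apply/subsetP => w /sel_kerP [wL w1]; apply/sel_kerP; split=> // f.
  have [->|fe] := eqVneq f e; last by rewrite -(w1 f) /sel S1E.
  (* Every term of [symp v w] off [e] vanishes, leaving [v (e, e \in S0) * sel S0 w e]; the first
     factor is 1, so [w] vanishes at the coordinate selected by [S0] too. *)
  have := lag_symp _ lagL _ _ vL wL; rewrite (symp_sel S0) (bigD1 e) //= big1.
    rewrite v0; move: ve; case: (v _) => //=.
    by rewrite addr0 mul0r add0r mul1r.
  move=> g ge; have wg : sel S0 w g = 0 by rewrite -(w1 g) /sel S1E.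
  by rewrite v0 wg mul0r mulr0 addr0.
exists v => //; apply/negP => /sel_kerP [_ /(_ e)].
by rewrite /sel eS1 negbK => v1; rewrite v1 in ve.
Qed.

(** Reduction over all of [E] makes every kernel vector vanish at both coordinates of each edge. *)
Lemma dm_lag_nonempty L : lagrangian L -> exists S, S \in dm_lag L.
Proof.
move=> lagL; have [S _ hS] := exists_reduced L setT set0 lagL.
exists S; apply/dm_lagP => v vL v0; apply/ffunP => -[e i].
by rewrite hS ?ffunE //; apply/sel_kerP.
Qed.

(* i = false corresponds to slide_ss a b and i = true to exch_ss a b. *)
Definition slide_vec a b (i : bool) v : {ffun E * bool -> bool} :=
  [ffun k => if k == (a, false) then v k + v (b, i)
             else if k == (b, ~~ i) then v k + v (a, true) else v k].

(* The vectors of L on which only the choice of coordinates at a and b matters. *)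
Definition ker_off L S a b :=
  [set v in L | [forall e, (e != a) ==> (e != b) ==> (sel S v e == 0)]].

Lemma ker_offP L S a b v :
  reflect (v \in L /\ forall e, e != a -> e != b -> sel S v e = 0)
          (v \in ker_off L S a b).
Proof.
rewrite inE; apply: (iffP andP) => [] [vL].
  move/forallP => H; split=> // e ea eb.
  by apply/eqP; move: (H e); rewrite ea eb.
move=> H; split=> //; apply/forallP => e.
by apply/implyP => ea; apply/implyP => eb; rewrite H.
Qed.

Lemma mem_dm_lag_ker_off L S S' a b : S' :\: [set a; b] = S :\: [set a; b] ->
  (S' \in dm_lag L) = [forall v in ker_off L S a b,
      [&& v (a, a \notin S') == 0 & v (b, b \notin S') == 0] ==> (v == 0)].
Proof.
move=> eS.
have selE v e : e != a -> e != b -> sel S' v e = sel S v e.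
  move=> /negPf ea /negPf eb; move/setP/(_ e): eS.
  by rewrite !inE ea eb /= => eSe; rewrite /sel eSe.
apply/dm_lagP/forall_inP => [H v /ker_offP [vL v0] | H v vL v0].
  apply/implyP => /andP [/eqP va /eqP vb]; apply/eqP/H => // e.
  have [->//|ea] := eqVneq e a; have [->//|eb] := eqVneq e b.
  by rewrite selE // v0.
have /H : v \in ker_off L S a b by apply/ker_offP; split=> // e ea eb; rewrite -selE.
by rewrite -[v (a, _)]/(sel S' v a) -[v (b, _)]/(sel S' v b) !v0 eqxx => /eqP.
Qed.

(** The coordinates [(b, i)] and [(a, true)] that get added elsewhere are themselves left alone, so
    a second application cancels the first. *)
Lemma slide_vecK a b i : a != b -> involutive (slide_vec a b i).
Proof.
move=> /negPf ab v; apply/ffunP => -[e j]; rewrite !ffunE !xpair_eqE !eqxx.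
rewrite (eq_sym b a) ab /=.
case: (e == a); case: (e == b); case: i; case: j; rewrite //=;
  by do ?[rewrite ?eqxx //=; case: (v _)].
Qed.

Lemma slide_vec_eq0 a b i v : a != b -> (slide_vec a b i v == 0) = (v == 0).
Proof.
move=> ab; have m0 : slide_vec a b i 0 = 0.
  by apply/ffunP => k; rewrite !ffunE; do 2 case: ifP => _ //.
by rewrite -[X in _ == X]m0 (inj_eq (inv_inj (slide_vecK a b i ab))).
Qed.

(* If no choice of coordinates at a and b is feasible the first case holds;
   otherwise n, m is the basis dual to the coordinates (a, al), (b, be). *)
Variant ker_off_spec L S a b : Prop :=
| KerOffDegenerate v of v \in ker_off L S a b & v != 0 &
    (forall i, v (a, i) = 0) & (forall i, v (b, i) = 0)
| KerOffPlane al be n m of n \in ker_off L S a b & m \in ker_off L S a b &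
    n (a, al) = true & n (b, be) = false & m (a, al) = false & m (b, be) = true &
    m (a, ~~ al) = n (b, ~~ be) &
    (forall v, v \in ker_off L S a b -> v = n *+ v (a, al) + m *+ v (b, be)).

Lemma ker_offD L S a b n m : lagrangian L ->
  n \in ker_off L S a b -> m \in ker_off L S a b -> n + m \in ker_off L S a b.
Proof.
move=> lagL /ker_offP [nL n0] /ker_offP [mL m0]; apply/ker_offP.
split=> [|e ea eb]; first exact: lagD.
by rewrite /sel ffunE; have := n0 e ea eb; have := m0 e ea eb; rewrite /sel => -> ->.
Qed.

(** Reduce [S] at [a] and [b]. If the result is not feasible, a nonzero kernel vector vanishes in
    all four coordinates at [a] and [b]. Otherwise [lag_full] provides [n] and [m], and isotropy
    makes their cross coordinates equal. *)
Lemma ker_off_cases L S a b : a != b -> lagrangian L -> ker_off_spec L S a b.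
Proof.
move=> ab lagL; have [S0 eS0 red] := exists_reduced L [set a; b] S lagL.
have selE v e : e != a -> e != b -> sel S0 v e = sel S v e.
  move=> /negPf ea /negPf eb; move/setP/(_ e): eS0.
  by rewrite !inE ea eb /= => eSe; rewrite /sel eSe.
have [feas|] := boolP (S0 \in dm_lag L); last first.
  rewrite inE negb_forall_in => /exists_inP [v vk v0].
  have /sel_kerP [vL vs] := vk.
  apply: (KerOffDegenerate _ _ _ _ v) => //; last 2 first.
  - by move=> i; apply: red; rewrite // !inE eqxx.
  - by move=> i; apply: red; rewrite // !inE eqxx orbT.
  by apply/ker_offP; split=> // e ea eb; rewrite -selE.
have [n nL sn] := lag_full _ lagL _ a feas.
have [m mL sm] := lag_full _ lagL _ b feas.
have ba : (b == a) = false by rewrite eq_sym (negPf ab).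
have nK : n \in ker_off L S a b.
  by apply/ker_offP; split=> // e ea eb; rewrite -selE // sn (negPf ea).
have mK : m \in ker_off L S a b.
  by apply/ker_offP; split=> // e ea eb; rewrite -selE // sm (negPf eb).
have na : n (a, a \notin S0) = true by rewrite -[LHS]/(sel S0 n a) sn eqxx.
have nb : n (b, b \notin S0) = false by rewrite -[LHS]/(sel S0 n b) sn ba.
have ma : m (a, a \notin S0) = false by rewrite -[LHS]/(sel S0 m a) sm (negPf ab).
have mb : m (b, b \notin S0) = true by rewrite -[LHS]/(sel S0 m b) sm eqxx.
apply: (KerOffPlane _ _ _ _ (a \notin S0) (b \notin S0) n m) => //.
  have := lag_symp _ lagL _ _ nL mL.
  rewrite (symp_sel S0) (bigD1 a) //= (bigD1 b) ?ba //= big1 => [|e /andP [ea eb]].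
    rewrite !sn !sm !eqxx (negPf ab) ba !negbK.
    by case: (m (a, _)); case: (n (b, _)); case: (n _); case: (m _).
  by rewrite sn sm (negPf ea) (negPf eb) mul0r mulr0.
move=> v /ker_offP [vL v0].
have /dm_lagP feasP := feas.
apply/eqP; rewrite -subr_eq0; apply/eqP; apply: feasP => [|e].
  have mulL (u : {ffun E * bool -> bool}) (c : bool) : u \in L -> u *+ c \in L.
    by case: c => // _; rewrite mulr0n lag0.
  have -> : forall u u' : {ffun E * bool -> bool}, u - u' = u + u'.
    by move=> u u'; apply/ffunP => k; rewrite !ffunE.
  by do !apply: lagD; rewrite // mulL.
rewrite /sel !(ffunE, ffunMnE).
have := sn e; have := sm e; rewrite /sel => -> ->.
have [->|ea] := eqVneq e a; first by rewrite (negPf ab); case: (v _); case: (v _).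
have [->|eb] := eqVneq e b; first by case: (v _); case: (v _).
by have := v0 e ea eb; rewrite -selE // /sel => ->; case: (v _); case: (v _).
Qed.

(** Since [slide_vec] changes nothing off [a] and [b], it maps [ker_off] of [L] onto that of the
    image, and the test is pulled back to [L]. *)
Lemma mem_dm_lag_slide_ker_off L S a b i : a != b ->
  (S \in dm_lag (slide_vec a b i @: L)) = [forall v in ker_off L S a b,
      [&& slide_vec a b i v (a, a \notin S) == 0 & slide_vec a b i v (b, b \notin S) == 0]
      ==> (v == 0)].
Proof.
move=> ab; rewrite (mem_dm_lag_ker_off _ S S a b) //.
have moveE v e j : e != a -> e != b -> slide_vec a b i v (e, j) = v (e, j).
  by move=> /negPf ea /negPf eb; rewrite ffunE !xpair_eqE ea eb.
apply/forall_inP/forall_inP => H v /ker_offP [vL v0].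
  rewrite -(slide_vec_eq0 a b i) //; apply: H; apply/ker_offP.
  split=> [|e ea eb]; first exact: imset_f.
  by rewrite /sel moveE //; apply: v0.
case/imsetP: vL v0 => w wL ->{v} v0; rewrite slide_vec_eq0 //; apply: H.
by apply/ker_offP; split=> // e ea eb; rewrite -(v0 e ea eb) /sel moveE.
Qed.

(** The plane consists of 0, [n], [m] and [n + m], so three vectors have to be tested. *)
Lemma forall_plane L S a b al be n m (Q : pred {ffun E * bool -> bool}) :
  lagrangian L -> n \in ker_off L S a b -> m \in ker_off L S a b ->
  n (a, al) = true -> n (b, be) = false -> m (a, al) = false -> m (b, be) = true ->
  (forall v, v \in ker_off L S a b -> v = n *+ v (a, al) + m *+ v (b, be)) ->
  [forall v in ker_off L S a b, Q v ==> (v == 0)] = [&& ~~ Q n, ~~ Q m & ~~ Q (n + m)].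
Proof.
move=> lagL nK mK na nb ma mb span.
have n0 : (n == 0) = false by apply/eqP => e; move: na; rewrite e ffunE.
have m0 : (m == 0) = false by apply/eqP => e; move: mb; rewrite e ffunE.
have nm0 : (n + m == 0) = false.
  by apply/eqP => /ffunP /(_ (a, al)); rewrite !ffunE na ma.
have nmK : n + m \in ker_off L S a b by apply: ker_offD.
apply/forall_inP/and3P => [H | [Qn Qm Qnm] v /span ->].
  have := H n nK; have := H m mK; have := H _ nmK.
  by rewrite n0 m0 nm0 !implybF.
case: (v (a, al)); case: (v (b, be)); rewrite ?mulr1n ?mulr0n ?addr0 ?add0r.
- by rewrite (negPf Qnm).
- by rewrite (negPf Qn).
- by rewrite (negPf Qm).
- by rewrite eqxx implybT.
Qed.

(** In the degenerate case all three memberships fail. Otherwise the plane is described by [al],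
    [be] and a symmetric 2 by 2 matrix with diagonal [x], [z] and off-diagonal entry [y], and the
    identity is checked on all booleans. *)
Lemma mem_dm_lag_slide L S a b i : a != b -> lagrangian L ->
  (S \in dm_lag (slide_vec a b i @: L)) =
  (S \in dm_lag L) (+)
    [&& a \in S, (b \in S) == i & symd S [set a; b] \in dm_lag L].
Proof.
move=> ab lagL; rewrite mem_dm_lag_slide_ker_off //.
have ba : (b == a) = false by rewrite eq_sym (negPf ab).
rewrite (mem_dm_lag_ker_off L S S a b) // (mem_dm_lag_ker_off L S (symd S [set a; b]) a b); last first.
  by apply/setP => e; rewrite !inE; case: (e == a); case: (e == b); case: (e \in S).
have -> : (a \notin symd S [set a; b]) = (a \in S) by rewrite mem_symd !inE eqxx addbT negbK.
have -> : (b \notin symd S [set a; b]) = (b \in S).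
  by rewrite mem_symd !inE eqxx orbT addbT negbK.
have mva v j : slide_vec a b i v (a, j) = if j then v (a, true) else v (a, false) + v (b, i).
  by rewrite ffunE !xpair_eqE !eqxx (negPf ab); case: j.
have mvb v j : slide_vec a b i v (b, j) = if j == ~~ i then v (b, j) + v (a, true) else v (b, j).
  by rewrite ffunE !xpair_eqE !eqxx ba.
case: (ker_off_cases L S a b ab lagL) => [v vK v0 va vb | al be n m nK mK na nb ma mb nm span].
  have degen (Q : pred {ffun E * bool -> bool}) : Q v ->
      [forall w in ker_off L S a b, Q w ==> (w == 0)] = false.
    move=> Qv; apply/negbTE; rewrite negb_forall_in; apply/exists_inP; exists v => //.
    by rewrite Qv.
  rewrite !degen ?andbF //= !(mva, mvb, va, vb) ?eqxx //.
  by do 2 case: ifP => _.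
rewrite !(forall_plane L S a b al be n m) // !mva !mvb !ffunE.
have zE (u : bool) : (u == 0) = ~~ u by case: u.
have pE (u u' : bool) : u + u' = u (+) u' by [].
have [x naE] : exists x, forall j, n (a, j) = if j == al then true else x.
  by exists (n (a, ~~ al)) => j; case: eqVneq => [->//|]; case: j; case: (al).
have [z mbE] : exists z, forall j, m (b, j) = if j == be then true else z.
  by exists (m (b, ~~ be)) => j; case: eqVneq => [->//|]; case: j; case: (be).
have [y [maE nbE]] : exists y, (forall j, m (a, j) = if j == al then false else y) /\
    (forall j, n (b, j) = if j == be then false else y).
  exists (n (b, ~~ be)); rewrite -{1}nm.
  by split=> j; case: eqVneq => [->//|]; case: j; case: (al); case: (be).
rewrite !(naE, nbE, maE, mbE) !zE !pE.
move: (a \in S) (b \in S); clear.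
by move: i al be x y z => [] [] [] [] [] [] [] [].
Qed.

End Lagrangian.

Arguments sel {E} S v e.
Arguments symp {E} v w.
Arguments slide_vec {E} a b i v.
Arguments dm_lag {E} L.
Arguments sel_ker {E} L S.
Arguments lagrangian {E} L.
Arguments symp_sel {E} S v w.
Arguments dm_lagP {E L S}.
Arguments sel_kerP {E L S v}.
Arguments lagD {E} [L].
Arguments lag0 {E} [L].
Arguments lag_symp {E} [L].
Arguments lag_full {E} [L].
Arguments dm_lag_nonempty {E} L.

(** * Binarity of the delta-matroid of a Lagrangian *)

Section Binary.
Variable E : finType.
Implicit Types (S A : {set E}) (L : {set {ffun E * bool -> bool}}).
Implicit Types (v : {ffun E * bool -> bool}) (e : E).

Lemma mem_twist (Phi : {set {set E}}) S A : (S \in twist Phi A) = (symd S A \in Phi).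
Proof.
have symdK : involutive (fun B : {set E} => symd B A).
  by move=> B; apply/setP => e; rewrite !mem_symd -addbA addbb addbF.
by rewrite /twist (can_imset_pre _ symdK) inE.
Qed.

(** Framed graphs have matrices over ['F_2] and Lagrangians have coordinates in [bool]; this field
    morphism carries determinants across. *)
Definition F2_of_bool (c : bool) : 'F_2 := c%:R.

Fact F2_of_bool_is_zmod_morphism : zmod_morphism F2_of_bool.
Proof. by do 2 case; apply/eqP. Qed.

Fact F2_of_bool_is_monoid_morphism : monoid_morphism F2_of_bool.
Proof. by split=> //; do 2 case; apply/eqP. Qed.

HB.instance Definition _ :=
  GRing.isZmodMorphism.Build bool 'F_2 F2_of_bool F2_of_bool_is_zmod_morphism.
HB.instance Definition _ :=
  GRing.isMonoidMorphism.Build bool 'F_2 F2_of_bool F2_of_bool_is_monoid_morphism.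

Lemma mem_nondeg (G : framed_graph E) (A : E -> E -> bool) (T : {set E}) :
  (forall e f, fg_entry G e f = F2_of_bool (A e f)) ->
  reflect (forall c : E -> bool, (forall f, f \notin T -> c f = false) ->
             (forall f, f \in T -> \sum_e c e * A e f = 0) -> forall f, c f = false)
          (T \in nondeg G).
Proof.
move=> GA; pose B : 'M[bool]_#|T| := \matrix_(i, j) A (enum_val i) (enum_val j).
have sumT (c : E -> bool) f : (forall e, e \notin T -> c e = false) ->
    \sum_e c e * A e f = \sum_(i < #|T|) c (enum_val i) * A (enum_val i) f.
  move=> cT; rewrite -(big_enum_val (fun e => c e * A e f)).
  by rewrite [LHS](bigID (mem T)) /= [X in _ + X]big1 ?addr0 // => e /cT ->; rewrite mul0r.
have -> : (T \in nondeg G) = (\det B != 0).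
  rewrite inE; have -> : induced_mx G T = map_mx F2_of_bool B.
    by apply/matrixP => i j; rewrite !mxE GA.
  by rewrite det_map_mx fmorph_eq0.
apply: (iffP idP) => [/det0P nd c cT cA f | H].
  apply/negbTE/negP => cf; have fT : f \in T.
    by apply: contraTT cf => /cT ->.
  apply: nd; exists (\row_i c (enum_val i)).
    apply/eqP => /rowP /(_ (enum_rank_in fT f)).
    by rewrite !mxE enum_rankK_in // cf.
  apply/rowP => j; rewrite !mxE -[RHS](cA (enum_val j) (enum_valP j)) sumT //.
  by apply: eq_bigr => i _; rewrite !mxE.
apply/det0P => -[r /eqP r0 rB]; apply: r0; apply/rowP => i.
(* The kernel row [r], extended by zero off [T]. *)
pose c e := if [pick k : 'I_#|T| | enum_val k == e] is Some k then r 0 k else false.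
have cE k : c (enum_val k) = r 0 k.
  rewrite /c; case: pickP => [k' /eqP /enum_val_inj ->//|/(_ k)].
  by rewrite eqxx.
have cT f : f \notin T -> c f = false.
  rewrite /c; case: pickP => // k /eqP <-.
  by rewrite enum_valP.
rewrite mxE -cE; apply: H => // f fT; rewrite sumT //.
move/rowP/(_ (enum_rank_in fT f)): rB; rewrite !mxE => rBf.
by rewrite -[RHS]rBf; apply: eq_bigr => k _; rewrite !mxE cE enum_rankK_in.
Qed.

(** Over a feasible [S0] the vectors [V e] dual to the selected coordinates span [L]; their other
    coordinates form [A], symmetric by isotropy. For [T = symd S S0], the coordinates of [comb c]
    selected by [S] are [c] off [T] and [c] times [A] on [T], so feasibility of [S] is
    nonsingularity of [A] on [T]. *)
Lemma binary_dm_lag L : lagrangian L -> binary_dm (dm_lag L).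
Proof.
move=> lagL; have [S0 feas] := dm_lag_nonempty L lagL.
have [V VL sV] := fin_all_exists2 (fun e => lag_full lagL S0 e feas).
pose A e f := V e (f, f \in S0).
have Asym e f : A e f = A f e.
  have := lag_symp lagL _ _ (VL e) (VL f); rewrite (symp_sel S0).
  rewrite big_split /= (bigD1 e) //= (sV e e) eqxx mul1r big1 ?addr0 => [|g ge]; last first.
    by rewrite sV (negPf ge) mul0r.
  rewrite (bigD1 f) //= (sV f f) eqxx mulr1 big1 ?addr0 => [|g ge]; last first.
    by rewrite sV (negPf ge) mulr0.
  by rewrite -/(A f e) -/(A e f); case: (A f e); case: (A e f).
have adj_sym : symmetric [rel e f | (e != f) && A e f].
  by move=> e f /=; rewrite eq_sym Asym.
have adj_irr : irreflexive [rel e f | (e != f) && A e f].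
  by move=> e /=; rewrite eqxx.
pose G := FramedGraph adj_sym adj_irr (fun e => A e e).
have GA e f : fg_entry G e f = F2_of_bool (A e f).
  by rewrite /fg_entry /=; case: eqVneq => [->|].
pose comb (c : E -> bool) := \sum_e V e *+ c e.
have combE c k : comb c k = \sum_e c e * V e k.
  rewrite /comb sum_ffunE; apply: eq_bigr => e _; rewrite ffunMnE.
  by case: (c e); rewrite ?mul1r ?mul0r.
have sel_comb c f : sel S0 (comb c) f = c f.
  rewrite /sel combE (bigD1 f) //= -[V f _]/(sel S0 (V f) f) sV eqxx mulr1.
  rewrite big1 ?addr0 // => e ef.
  by rewrite -[V e _]/(sel S0 (V e) f) sV eq_sym (negPf ef) mulr0.
have combL c : comb c \in L.
  rewrite /comb; apply: (big_ind (fun v => v \in L)) => [|v w|e _]; [exact: lag0 | exact: lagD |].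
  by case: (c e); [exact: VL | rewrite mulr0n lag0].
exists E, G, S0, id; split; first by exists id.
apply/setP => S; rewrite mem_twist.
under eq_imset => B do rewrite imset_id.
rewrite imset_id; set T := symd S S0.
have selN v f : f \notin T -> sel S v f = sel S0 v f.
  by rewrite mem_symd /sel; case: (f \in S); case: (f \in S0).
have selT v f : f \in T -> sel S v f = v (f, f \in S0).
  by rewrite mem_symd /sel; case: (f \in S); case: (f \in S0).
apply/(mem_nondeg G A T GA)/dm_lagP => [H v vL v0 | H c cT cA f].
  have span : v = comb (sel S0 v).
    apply/eqP; rewrite -subr_eq0; apply/eqP.
    apply: (dm_lagP feas) => [|e].
      have -> : v - comb (sel S0 v) = v + comb (sel S0 v).
        by apply/ffunP => k; rewrite !ffunE.
      exact: lagD.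
    have := sel_comb (sel S0 v) e; rewrite /sel !ffunE => ->.
    by case: (v _).
  have c0 : forall f, sel S0 v f = false.
    apply: H => f fT; first by rewrite -selN.
    by rewrite -[RHS](v0 f) selT // {2}span combE.
  rewrite span /comb big1 // => e _.
  by rewrite c0 mulr0n.
rewrite -sel_comb (H (comb c)) //; first by rewrite /sel ffunE.
move=> e; have [eT|eT] := boolP (e \in T); last by rewrite selN // sel_comb cT.
by rewrite selT // combE cA.
Qed.

End Binary.

(** * Linear algebra over F_2 for involutions *)

Lemma sum_involution (T : finType) (t : T -> T) (F : T -> bool) :
  involutive t -> (forall z, t z != z) -> (forall z, F (t z) = F z) -> \sum_z F z = 0.
Proof.
(* [P] selects the element of smaller rank in each two-element orbit; its partner carries the same
   value and cancels it. *)
move=> tK tN Ft; pose P z := (enum_rank z < enum_rank (t z))%N.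
rewrite (bigID P) /= [X in _ + X](reindex_inj (inv_inj tK)) /=.
have -> : \sum_(z | ~~ P (t z)) F (t z) = \sum_(z | P z) F z.
  apply: eq_big => z; last by rewrite Ft.
  rewrite /P tK -leqNgt leq_eqVlt.
  have -> // : (enum_rank z == enum_rank (t z) :> nat) = false.
  by rewrite val_eqE (inj_eq enum_rank_inj) eq_sym (negPf (tN z)).
by case: (\sum_(z | P z) F z).
Qed.

(* Fredholm alternative over F_2 for the coboundary map of the graph formed by
   the orbits of t and s: a vector annihilating the coboundaries is a cycle. *)
Lemma involutions_potential (T : finType) (t s : T -> T) (h : T -> bool) :
  involutive t -> involutive s ->
  (forall w : T -> bool, (forall z, w (t z) = w z) -> (forall z, w (s z) = w z) ->
     forall x y, w x = w y) ->
  (forall c : T -> bool, (forall x y, c x + c (s x) = c y + c (s y)) ->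
     \sum_z h z * c z = 0) ->
  exists2 u : T -> bool, (forall z, u (t z) = u z) & (forall z, u z + u (s z) = h z).
Proof.
move=> tK sK trans hc.
pose P (r : T -> T) : 'M[bool]_#|T| := \matrix_(i, k) (enum_val i == r (enum_val k)).
have mulP r m (X : 'M[bool]_(#|T|, m)) z j : involutive r ->
    ((1%:M + P r) *m X) (enum_rank z) j = X (enum_rank z) j + X (enum_rank (r z)) j.
  move=> rK; rewrite mulmxDl mul1mx mxE; congr (_ + _).
  rewrite mxE (bigD1 (enum_rank (r z))) //= big1 => [|k kz].
    by rewrite mxE !enum_rankK rK eqxx mul1r addr0.
  rewrite mxE enum_rankK; case: eqP => [e|]; last by rewrite mul0r.
  by rewrite e rK enum_valK eqxx in kz.
have Pmul r (D : 'rV[bool]_#|T|) z :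
    (D *m (1%:M + P r)) 0 (enum_rank z) = D 0 (enum_rank z) + D 0 (enum_rank (r z)).
  rewrite mulmxDr mulmx1 mxE; congr (_ + _).
  rewrite mxE (bigD1 (enum_rank (r z))) //= big1 => [|i iz].
    by rewrite mxE !enum_rankK eqxx mulr1 addr0.
  rewrite mxE enum_rankK; case: eqP => [e|]; last by rewrite mulr0.
  by rewrite -e enum_valK eqxx in iz.
(* A row [D] with [D *m M = b] is the potential sought: the first block makes it invariant under
   [t], the second makes its coboundary along [s] equal to [h]. *)
pose M := row_mx (1%:M + P t) (1%:M + P s).
pose b : 'rV_(#|T| + #|T|) := row_mx 0 (\row_k h (enum_val k)).
have /submxP [D] : (b <= M)%MS.
  rewrite submxE; apply/eqP; rewrite -[cokermx M]vsubmxK mul_row_col mul0mx add0r.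
  have := mulmx_coker M; rewrite -[X in M *m X]vsubmxK mul_row_col.
  set K1 := usubmx _; set K2 := dsubmx _ => MK; apply/matrixP => i j.
  have {}MK z : K1 (enum_rank z) j + K1 (enum_rank (t z)) j =
               K2 (enum_rank z) j + K2 (enum_rank (s z)) j.
    move/matrixP/(_ (enum_rank z) j): MK; rewrite [LHS]mxE !mulP // [RHS]mxE.
    by move/eqP; rewrite addr_eq0 => /eqP.
  rewrite !mxE; under eq_bigr => k _ do rewrite mxE.
  rewrite -[RHS](hc (fun z => K2 (enum_rank z) j)).
    rewrite (reindex enum_rank) /=; last by apply: onW_bij; apply: enum_rank_bij.
    by apply: eq_bigr => z _; rewrite enum_rankK.
  (* The [s]-coboundary of this column of [K2] is [s]-invariant; by [MK] it is also the
     [t]-coboundary of a column of [K1], hence [t]-invariant, and so it is constant. *)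
  apply: trans => z; last by rewrite sK addrC.
  by rewrite -!MK tK addrC.
rewrite mul_mx_row => /eq_row_mx [/rowP bt /rowP bs].
exists (fun z => D 0 (enum_rank z)) => z.
  have := bt (enum_rank z); rewrite Pmul mxE.
  by case: (D 0 _); case: (D 0 _).
by have := bs (enum_rank z); rewrite Pmul mxE enum_rankK => ->.
Qed.

Fact bool_addE (x y : bool) : x + y = x (+) y. Proof. by []. Qed.
Fact bool_mulE (x y : bool) : x * y = x && y. Proof. by []. Qed.
Fact bool_eq0E (x : bool) : (x == 0) = ~~ x. Proof. by case: x. Qed.
Definition boolE := (bool_eq0E, bool_addE, bool_mulE).

(** * Corner functions of a ribbon graph and the Lagrangian of their jumps *)

Section RibbonGraph.
Variable E : finType.
Implicit Types (t : flag E -> flag E) (u w : {ffun flag E -> bool}) (S : {set E}) (e : E).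

Definition ft (i : bool) : flag E -> flag E := if i then @ft2 E else @ft0 E.

Lemma ftK i : involutive (ft i).
Proof. by case: i => -[[e []] []]. Qed.

Lemma fedge_ft i z : fedge (ft i z) = fedge z.
Proof. by case: i; case: z => -[]. Qed.

(* One coordinate per edge and direction: the jump of u across the edge, along
   ft0 for the index false and along ft2 for the index true. *)
Definition jumps u : {ffun E * bool -> bool} :=
  [ffun k => u (k.1, false, false) + u (ft k.2 (k.1, false, false))].

Definition even_edges u : bool :=
  [forall e, u (e, false, false) + u (e, false, true) + u (e, true, false) + u (e, true, true) == 0].

Definition corner_functions t :=
  [set u : {ffun flag E -> bool} | [forall z, u (t z) == u z] && even_edges u].

Definition lag_of t := jumps @: corner_functions t.

(** Connectedness is put in terms of invariant functions because a corner function with zero jumps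
    is one. *)
Record ribbon_graph t : Prop := RibbonGraph {
  ribbonK : involutive t;
  ribbonN : forall z, t z != z;
  ribbon_conn : forall u : flag E -> bool, (forall z, u (t z) = u z) ->
    (forall i z, u (ft i z) = u z) -> forall z z', u z = u z' }.

Lemma corner_functionsP t u :
  reflect ((forall z, u (t z) = u z) /\ even_edges u) (u \in corner_functions t).
Proof.
rewrite inE; apply: (iffP andP) => -[ut ue]; split=> //.
  by move=> z; apply/eqP/(forallP ut).
by apply/forallP => z; rewrite ut.
Qed.

(** The two [ft i] pairs of an edge have the same jump because the four values sum to zero, so the
    jump may be read at any flag. *)
Lemma jumpsE u i z : even_edges u -> jumps u (fedge z, i) = u z + u (ft i z).
Proof.
case: z => -[e h] s /forallP /(_ e); rewrite ffunE /ft /ft0 /ft2 /=.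
rewrite !boolE; case: i; case: h; case: s => /=;
  by move: (u (e, false, false)) (u (e, false, true)) (u (e, true, false)) (u (e, true, true)) => [] [] [] [].
Qed.

Lemma jumpsD u w : jumps (u + w) = jumps u + jumps w.
Proof. by apply/ffunP => k; rewrite !ffunE addrACA. Qed.

Lemma jumps_eq0 u : (forall i z, u (ft i z) = u z) -> jumps u = 0.
Proof. by move=> ui; apply/ffunP => k; rewrite !ffunE ui; case: (u _). Qed.

Lemma ft_jumps0 u : even_edges u -> jumps u = 0 -> forall i z, u (ft i z) = u z.
Proof.
move=> ue u0 i z; have := jumpsE u i z ue; rewrite u0 ffunE.
by case: (u z); case: (u _).
Qed.

Lemma sel_jumps S u z : even_edges u ->
  sel S (jumps u) (fedge z) = u z + u (ft (fedge z \notin S) z).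
Proof. by move=> ue; rewrite /sel jumpsE. Qed.

Lemma bdry_relE t S z z' :
  bdry_rel t S z z' = (z' == ft (fedge z \notin S) z) || (z' == t z).
Proof. by rewrite /bdry_rel; case: (fedge z \in S). Qed.

Lemma even_of_side S (u : {ffun flag E -> bool}) :
  (forall z, u (ft (fedge z \notin S) z) = u z) -> even_edges u.
Proof.
move=> us; apply/forallP => e.
have := us (e, false, false); have := us (e, true, true).
rewrite /fedge /ft /ft0 /ft2 /= !boolE; case: (e \in S) => /=;
  by move: (u (e, false, false)) (u (e, false, true)) (u (e, true, false)) (u (e, true, true)) => [] [] [] [].
Qed.

(** Vanishing selected jumps mean that a corner function is constant on each boundary component of
    [S]; vanishing of all jumps means, by connectedness, that it is constant. The indicator of one
    component serves as test function. *)
Lemma dm_of_lag t : ribbon_graph t -> dm_of t = dm_lag (lag_of t).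
Proof.
move=> rt; apply/setP => S; rewrite inE.
apply/forallP/dm_lagP => [H _ /imsetP [u /corner_functionsP [ut ue] ->] u0 | H z].
  apply: jumps_eq0 => i z.
  have step z1 z2 : connect (bdry_rel t S) z1 z2 -> u z2 = u z1.
    move=> /connectP [p pp ->]; elim: p z1 pp => //= z3 p IH z1 /andP [z13 pp].
    rewrite IH //; move: z13; rewrite bdry_relE => /orP [] /eqP -> //.
    by have := u0 (fedge z1); rewrite sel_jumps //; case: (u z1); case: (u _).
  exact/step/(forallP (H z)).
have connt z1 : connect (bdry_rel t S) z1 (t z1).
  by apply: connect1; rewrite bdry_relE eqxx orbT.
have conns z1 : connect (bdry_rel t S) z1 (ft (fedge z1 \notin S) z1).
  by apply: connect1; rewrite bdry_relE eqxx.
pose u : {ffun flag E -> bool} := [ffun z' => connect (bdry_rel t S) z z'].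
have ut z1 : u (t z1) = u z1.
  rewrite !ffunE; apply/idP/idP => c; last exact: connect_trans c (connt z1).
  by apply: (connect_trans c); rewrite -{2}(ribbonK _ rt z1).
have us z1 : u (ft (fedge z1 \notin S) z1) = u z1.
  rewrite !ffunE; apply/idP/idP => c; last exact: connect_trans c (conns z1).
  apply: (connect_trans c).
  by have := conns (ft (fedge z1 \notin S) z1); rewrite fedge_ft ftK.
have ue : even_edges u := even_of_side S u us.
have uL : jumps u \in lag_of t by apply/imset_f/corner_functionsP.
have /(ft_jumps0 u ue) ui : jumps u = 0.
  apply: H uL _ => e; rewrite (sel_jumps S u (e, false, false)) // us.
  by case: (u _).
apply/forallP => z'; have := ribbon_conn _ rt u ut ui z z'.
by rewrite !ffunE connect0 => <-.
Qed.

Lemma sum_flags (F : flag E -> bool) :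
  \sum_z F z = \sum_e (F (e, false, false) + F (e, false, true) + F (e, true, false) + F (e, true, true)).
Proof.
rewrite (eq_bigr (fun z : flag E => F (z.1.1, z.1.2, z.2))); last by case=> -[].
rewrite -(pair_big predT predT (fun eh s => F (eh.1, eh.2, s))) /=.
rewrite -(pair_big predT predT (fun e h => \sum_s F (e, h, s))) /=.
apply: eq_bigr => e _; rewrite !big_bool /=.
by do 4 case: (F _).
Qed.

(** Evenness turns the form at each edge into a sum over its four flags; in the sum over all flags
    the corner pairing can then cancel terms. *)
Lemma symp_jumps u w : even_edges u -> even_edges w ->
  symp (jumps u) (jumps w) = \sum_z u z * w z.
Proof.
move=> /forallP ue /forallP we; rewrite sum_flags; apply: eq_bigr => e _.
rewrite !ffunE /ft /ft0 /ft2 /=; move: (ue e) (we e).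
rewrite !boolE.
move: (u (e, false, false)) (u (e, false, true)) (u (e, true, false)) (u (e, true, true)) => [] [] [] [] //= _;
  by move: (w (e, false, false)) (w (e, false, true)) (w (e, true, false)) (w (e, true, true)) => [] [] [] [].
Qed.

(** Isotropy: a product of two corner functions takes equal values at the two flags of a corner.
    Fullness: a corner function whose boundary-step jump is the indicator of [e] is a potential,
    supplied by [involutions_potential]. *)
Lemma lagrangian_lag_of t : ribbon_graph t -> lagrangian (lag_of t).
Proof.
move=> rt; split.
- apply/imsetP; exists 0; last by apply/ffunP => k; rewrite !ffunE.
  apply/corner_functionsP; split=> [z|]; first by rewrite !ffunE.
  by apply/forallP => e; rewrite !ffunE.
- move=> _ _ /imsetP [u /corner_functionsP [ut ue] ->] /imsetP [w /corner_functionsP [wt we] ->].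
  rewrite -jumpsD; apply/imset_f/corner_functionsP; split=> [z|]; first by rewrite !ffunE ut wt.
  apply/forallP => e; rewrite !ffunE.
  have := forallP we e; have := forallP ue e; rewrite !boolE.
  move: (u (e, false, false)) (u (e, false, true)) (u (e, true, false)) (u (e, true, true)) => [] [] [] [] //= _;
    by move: (w (e, false, false)) (w (e, false, true)) (w (e, true, false)) (w (e, true, true)) => [] [] [] [].
- move=> _ _ /imsetP [u /corner_functionsP [ut ue] ->] /imsetP [w /corner_functionsP [wt we] ->].
  rewrite symp_jumps //; apply: (sum_involution _ t) => [||z]; [exact: ribbonK | exact: ribbonN |].
  by rewrite ut wt.
move=> S e /dm_lagP feas.
pose s z := ft (fedge z \notin S) z.
have sK : involutive s by move=> z; rewrite /s fedge_ft ftK.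
case: (involutions_potential _ t s (fun z => fedge z == e) (ribbonK _ rt) sK) => [w wt ws|c cs|u ut us].
- pose u := [ffun z => w z] : {ffun flag E -> bool}.
  have ue : even_edges u by apply: (even_of_side S) => z; rewrite !ffunE -/(s z) ws.
  have /(ft_jumps0 u ue) ui : jumps u = 0.
    apply: feas => [|f].
      by apply/imset_f/corner_functionsP; split=> // z; rewrite !ffunE.
    rewrite (sel_jumps S u (f, false, false)) // !ffunE -/(s _) ws.
    by case: (w _).
  by apply: (ribbon_conn _ rt) => // i z; have := ui i z; rewrite !ffunE.
- rewrite sum_flags (bigD1 e) //= big1 => [|f fe]; last by rewrite /fedge /= (negPf fe) !mul0r.
  rewrite /fedge /= eqxx !mul1r addr0.
  (* The four flags of [e] form two [s]-pairs, represented by these two flags, and [cs] gives both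
     pairs the same sum. *)
  have := cs (e, false, false) (e, true, true); rewrite /s /fedge /ft /ft0 /ft2 /= !boolE.
  case: (e \in S) => /=;
    by move: (c (e, false, false)) (c (e, false, true)) (c (e, true, false)) (c (e, true, true)) => [] [] [] [].
pose w := [ffun z => u z] : {ffun flag E -> bool}.
have we : even_edges w.
  apply/forallP => f; rewrite !ffunE.
  have := us (f, false, false); have := us (f, true, true).
  rewrite /s /fedge /ft /ft0 /ft2 /= !boolE; case: (f \in S) => /= <-;
    by move: (u (f, false, false)) (u (f, false, true)) (u (f, true, false)) (u (f, true, true)) => [] [] [] [].
exists (jumps w).
  by apply/imset_f/corner_functionsP; split=> // z; rewrite !ffunE.
by move=> f; rewrite (sel_jumps S w (f, false, false)) // !ffunE -/(s _) us.
Qed.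
End RibbonGraph.

Arguments ft {E} i _.
Arguments jumps {E} u.
Arguments even_edges {E} u.
Arguments corner_functions {E} t.
Arguments lag_of {E} t.
Arguments ribbon_graph {E} t.
Arguments ribbonK {E} [t].
Arguments ribbonN {E} [t].
Arguments ribbon_conn {E} [t].
Arguments ftK {E} i _.
Arguments fedge_ft {E} i z.
Arguments jumpsE {E} u i z.
Arguments corner_functionsP {E t u}.
Arguments ft_jumps0 {E} [u].

(** * The two moves on flags and their effect on the Lagrangian *)

Section SecondMove.
Variable E : finType.
Implicit Types (t : flag E -> flag E) (u : {ffun flag E -> bool}) (x y w : flag E).

(* slide_eg for i = false and exch_eg for i = true *)
Definition flag_move t x (i : bool) : flag E -> flag E :=
  let y := t x in let xb := ft2 x in
  let p := t xb in let z := ft i y in let r := t z in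
  if p == z then t else
  fun w => if w == p then y else if w == y then p else
           if w == z then xb else if w == xb then z else
           if w == x then r else if w == r then x else t w.

(* Turns functions constant on the corners of t into functions constant on those of
   flag_move t x i when y = t x; its effect on jumps is slide_vec. *)
Definition shift x y (i : bool) u : {ffun flag E -> bool} :=
  [ffun w => u w
    + ((fedge w == fedge x) && (w.1.2 == x.1.2)) * jumps u (fedge y, i)
    + ((fedge w == fedge y) && (if i then w.1.2 == y.1.2 else w.2 == y.2))
      * jumps u (fedge x, true)].

(** Each correction is a multiple of the indicator of two flags of one edge. *)
Lemma even_edges_shift x y i u : even_edges u -> even_edges (shift x y i u).
Proof.
move=> /forallP ue; apply/forallP => e; move: (ue e); rewrite /shift.
move: (jumps u (fedge x, true)) (jumps u (fedge y, i)) => al be.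
rewrite !ffunE /fedge /= !boolE.
move: (u (e, false, false)) (u (e, false, true)) (u (e, true, false)) (u (e, true, true)).
move: (e == _) (e == _) (x.1.2) (y.1.2) y.2 => ex ey hx hy sy a b c d.
by case: ex; case: ey; rewrite /= ?addbF //; case: i; case: hx; case: hy; case: sy => /=;
  move: a b c d al be => [] [] [] [] // [] [].
Qed.

(** The correction at [x] is constant along [ft2], so only the coordinate [(fedge x, false)] feels
    it; the one at [y] is constant along [ft i], so only [(fedge y, ~~ i)] does. *)
Lemma jumps_shift x y i u : fedge x != fedge y ->
  jumps (shift x y i u) = slide_vec (fedge x) (fedge y) i (jumps u).
Proof.
move=> /negPf xy; have yx : (fedge y == fedge x) = false by rewrite eq_sym.
apply/ffunP => -[e j]; rewrite [RHS]ffunE !xpair_eqE [LHS]ffunE /shift.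
move: (jumps u (fedge x, true)) (jumps u (fedge y, i)) => al be.
rewrite !ffunE /fedge /ft /ft0 /ft2 /= !boolE.
rewrite -/(fedge x) -/(fedge y); have [->|ex] := eqVneq e (fedge x).
  case: j => /=; rewrite ?eqxx ?xy /=; move: (u _) (u _) x.1.2 => a b [];
    by move: a b be => [] [] [].
have [->|ey] := eqVneq e (fedge y); last first.
  by case: j => /=; rewrite (negPf ex) (negPf ey) /= !addbF.
case: i; case: j => /=; rewrite ?eqxx ?yx /=; move: (u _) (u _) y.1.2 y.2 => a b [] [];
  by move: a b al => [] [] [].
Qed.

Lemma shiftE x y i u : even_edges u -> fedge x != fedge y ->
  [/\ shift x y i u x = u x + (u y + u (ft i y)),
      shift x y i u (ft2 x) = u (ft2 x) + (u y + u (ft i y)),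
      shift x y i u y = u y + (u x + u (ft2 x)) &
      shift x y i u (ft i y) = u (ft i y) + (u x + u (ft2 x))] /\
  forall w, w \notin [:: x; ft2 x; y; ft i y] -> shift x y i u w = u w.
Proof.
move=> ue /negPf xy; have yx : (fedge y == fedge x) = false by rewrite eq_sym.
rewrite -(jumpsE u i y ue) -[ft2 x]/(ft true x) -(jumpsE u true x ue).
split; last first.
  case=> -[e h] s wN; rewrite ffunE.
  have -> : (fedge (e, h, s) == fedge x) && ((e, h, s).1.2 == x.1.2) = false.
    apply: contraNF wN; case: x {xy yx} => -[ex hx] sx; rewrite /fedge /= => /andP [/eqP -> /eqP ->].
    by rewrite !inE /ft /ft2 !xpair_eqE !eqxx /=; case: s; case: sx.
  have -> : (fedge (e, h, s) == fedge y) && (if i then (e, h, s).1.2 == y.1.2 else (e, h, s).2 == y.2) = false.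
    apply: contraNF wN; case: y {xy yx} => -[ey hy] sy; rewrite /fedge /= => /andP [/eqP ->].
    by rewrite !inE /ft; case: i => /= /eqP ->; rewrite /ft2 /ft0 !xpair_eqE !eqxx /=;
      [case: s; case: sy | case: h; case: hy]; rewrite ?orbT.
  by rewrite !mul0r !addr0.
by split; rewrite ffunE ?fedge_ft ?xy ?yx ?eqxx /= ?eqxx ?mul1r ?mul0r ?addr0 //;
  case: i => /=; rewrite ?eqxx ?mul1r ?mul0r ?addr0.
Qed.

Section Moved.
Variables (t : flag E -> flag E) (x : flag E) (i : bool).
Hypotheses (rt : ribbon_graph t) (xy : fedge x != fedge (t x)).
Let y := t x.
Let z := ft i y.
Let p := t (ft2 x).
Let r := t z.
Let t' := flag_move t x i.

(** If [p = z], then [r = ft2 x] and the flags collapse into two corners, where the move is trivial;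
    hence the separate case. *)
Lemma flag_move_uniq : p != z -> uniq [:: p; y; z; ft2 x; x; r].
Proof.
move=> pz; have tI := inv_inj (ribbonK rt).
have xb : ft2 x != x by apply: contraTneq isT => /(congr1 snd) /=; case: (x.2).
have zy : z != y.
  by rewrite /z /ft; case: i; apply: contraTneq isT;
    [move/(congr1 snd) | move/(congr1 (fun w : flag E => w.1.2))] => /=;
    [case: (y.2) | case: (y.1.2)].
have neq w w' : fedge w != fedge w' -> w != w' by apply: contraNneq => ->.
have ed2 : fedge (ft2 x) = fedge x by exact: (fedge_ft true x).
have edz : fedge z = fedge y by exact: fedge_ft.
have xyb : x != y by exact: neq.
have xz : x != z by apply: neq; rewrite edz.
have xby : ft2 x != y by apply: neq; rewrite ed2.
have xbz : ft2 x != z by apply: neq; rewrite ed2 edz.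
have py : p != y by rewrite (inj_eq tI).
have pxb : p != ft2 x by exact: ribbonN.
have px : p != x by rewrite -(inj_eq tI) (ribbonK rt).
have pr : p != r by rewrite (inj_eq tI).
have yr : y != r by rewrite (inj_eq tI).
have zr : z != r by rewrite eq_sym ribbonN.
have xbr : ft2 x != r by rewrite -(inj_eq tI) (ribbonK rt).
have xr : x != r by rewrite -(inj_eq tI) (ribbonK rt) eq_sym.
by rewrite /= !inE !negb_or py pz pxb px pr yr zr xbr xr
  (eq_sym y z) zy (eq_sym y (ft2 x)) xby (eq_sym y x) xyb (eq_sym z (ft2 x)) xbz
  (eq_sym z x) xz xb.
Qed.

Lemma flag_moveE : p != z ->
  [/\ t' p = y, t' y = p, t' z = ft2 x & t' (ft2 x) = z] /\ [/\ t' x = r, t' r = x &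
  forall w, w \notin [:: p; y; z; ft2 x; x; r] -> t' w = t w].
Proof.
move=> pz; have := flag_move_uniq pz.
rewrite /= !inE !negb_or -!andbA => /and5P [py _ pxb px /and5P [pr yz yxb yx /and5P [yr zxb zx zr]]].
move=> /and4P [xbx xbr xr _].
have E1 w : t' w = if w == p then y else if w == y then p else
           if w == z then ft2 x else if w == ft2 x then z else
           if w == x then r else if w == r then x else t w.
  by rewrite /t' /flag_move (negPf pz).
have F w w' : w != w' -> (w == w' = false) * (w' == w = false).
  by move=> /negPf ne; split; rewrite // eq_sym.
do !split; rewrite ?E1; last first.
  by move=> w; rewrite !inE !negb_or E1 => /and5P [/negPf -> /negPf -> /negPf -> /negPf -> /andP [/negPf -> /negPf ->]].
all: rewrite ?eqxx ?(F _ _ py) ?(F _ _ pz) ?(F _ _ pxb) ?(F _ _ px) ?(F _ _ pr) ?(F _ _ yz)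
  ?(F _ _ yxb) ?(F _ _ yx) ?(F _ _ yr) ?(F _ _ zxb) ?(F _ _ zx) ?(F _ _ zr)
  ?(F _ _ xbx) ?(F _ _ xbr) ?(F _ _ xr) //.
Qed.

Lemma flag_move_fix : p = z -> t' = t.
Proof. by move=> pz; rewrite /t' /flag_move -/y -/z -/p pz eqxx. Qed.

(** The union of the corners {x, y}, {ft2 x, p}, {z, r}, which for [p != z] the move pairs anew as
    {p, y}, {ft2 x, z}, {x, r}. *)
Let six w := w \in [:: p; y; z; ft2 x; x; r].

Lemma six_t w : six w -> six (t w).
Proof.
rewrite /six !inE => /or4P [|||/or3P [||]] /eqP ->;
  by rewrite ?(ribbonK rt) /p /r ?(ribbonK rt) ?eqxx ?orbT.
Qed.

Lemma six_tN w : ~~ six w -> ~~ six (t w).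
Proof. by apply: contraNN => /six_t; rewrite (ribbonK rt). Qed.

Lemma flag_moveK : involutive t'.
Proof.
have [pz|pz] := eqVneq p z; first by rewrite flag_move_fix //; exact: ribbonK.
have [[e1 e2 e3 e4] [e5 e6 eo]] := flag_moveE pz.
move=> w; have [|wN] := boolP (six w); last by rewrite !eo ?(ribbonK rt) ?six_tN.
rewrite /six !inE => /or4P [|||/or3P [||]] /eqP ->;
  by rewrite ?(e1, e2, e3, e4, e5, e6).
Qed.

Lemma flag_moveN w : t' w != w.
Proof.
have [pz|pz] := eqVneq p z; first by rewrite flag_move_fix //; exact: ribbonN.
have := flag_move_uniq pz.
have [[e1 e2 e3 e4] [e5 e6 eo]] := flag_moveE pz.
have [|wN] := boolP (six w); last by rewrite eo // ribbonN.
rewrite /= !inE !negb_or -!andbA => w6 /and5P [py _ _ _ /and5P [_ _ _ _ /and5P [_ zxb _ _ /and4P [_ _ xr _]]]].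
move: w6; rewrite /six !inE => /or4P [|||/or3P [||]] /eqP ->;
  by rewrite ?(e1, e2, e3, e4, e5, e6) // eq_sym.
Qed.

(** As [u x = u y], the value at [y] becomes [u (ft2 x) = u p], the value at [x] becomes
    [u z = u r], and the values at [ft2 x] and [z] become equal. *)
Lemma shift_corner_functions u : u \in corner_functions t -> shift x y i u \in corner_functions t'.
Proof.
move=> /corner_functionsP [ut ue]; apply/corner_functionsP; split; last exact: even_edges_shift.
have [[s1 s2 s3 s4] so] := shiftE x y i u ue xy.
have uy : u y = u x by rewrite /y ut.
have up : u p = u (ft2 x) by rewrite /p ut.
have [pz|pz] := eqVneq p z.
  have txb : t (ft2 x) = z by [].
  have tz : t z = ft2 x by rewrite -txb (ribbonK rt).
  have uz : u z = u (ft2 x) by rewrite -up pz.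
  rewrite flag_move_fix // => w; have [|wN] := boolP (w \in [:: x; ft2 x; y; z]).
    rewrite !inE => /or4P [] /eqP ->; rewrite ?txb ?tz ?(ribbonK rt) -/y ?s1 ?s2 ?s3 ?s4 -/z uy uz;
      by rewrite !boolE; move: (u x) (u (ft2 x)) => [] [].
  rewrite !so ?ut //; apply: contraNN wN; rewrite !inE => /or4P [] /eqP tw;
    by rewrite -(ribbonK rt w) tw ?txb ?tz ?(ribbonK rt) -/y ?eqxx ?orbT.
have [[e1 e2 e3 e4] [e5 e6 eo]] := flag_moveE pz.
have := flag_move_uniq pz.
rewrite /= !inE !negb_or -!andbA => /and5P [py pz' pxb px /and5P [pr yz yxb yx /and5P [yr zxb zx zr /and4P [xbx xbr xr _]]]].
have ur : u r = u z by rewrite /r ut.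
have sp : shift x y i u p = u p by rewrite so // !inE !negb_or px pxb py pz.
have sr : shift x y i u r = u r by rewrite so // !inE !negb_or !(eq_sym r) xr xbr yr zr.
move=> w; have [|wN] := boolP (six w); last first.
  rewrite eo // !so ?ut //.
    by apply: contraNN wN; rewrite /six !inE => /or4P [] ->; rewrite ?orbT.
  by apply: contraNN (six_tN _ wN); rewrite /six !inE => /or4P [] ->; rewrite ?orbT.
rewrite /six !inE => /or4P [|||/or3P [||]] /eqP ->;
  rewrite ?(e1, e2, e3, e4, e5, e6) ?(s1, s2, s3, s4, sp, sr) -/z ?uy ?up ?ur !boolE.
all: move: (u x) (u (ft2 x)) (u z) => [] [] [] //.
Qed.

Lemma unshift_corner_functions u : u \in corner_functions t' -> shift x y i u \in corner_functions t.
Proof.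
have [pz|pz] := eqVneq p z; first by have := shift_corner_functions u; rewrite flag_move_fix.
move=> /corner_functionsP [ut ue]; apply/corner_functionsP; split; last exact: even_edges_shift.
have [[s1 s2 s3 s4] so] := shiftE x y i u ue xy.
have [[e1 e2 e3 e4] [e5 e6 eo]] := flag_moveE pz.
have up : u p = u y by rewrite -(ut y) e2.
have uz : u z = u (ft2 x) by rewrite -(ut z) e3.
have ur : u r = u x by rewrite -(ut x) e5.
have := flag_move_uniq pz.
rewrite /= !inE !negb_or -!andbA => /and5P [py _ pxb px /and5P [_ _ _ _ /and5P [yr _ _ zr /and4P [_ xbr xr _]]]].
have sp : shift x y i u p = u p by rewrite so // !inE !negb_or px pxb py pz.
have sr : shift x y i u r = u r by rewrite so // !inE !negb_or !(eq_sym r) xr xbr yr zr.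
have ty : t y = x by rewrite /y (ribbonK rt).
have tp : t p = ft2 x by rewrite /p (ribbonK rt).
have tr : t r = z by rewrite /r (ribbonK rt).
move=> w; have [|wN] := boolP (six w); last first.
  rewrite !so -?eo ?ut //.
    by apply: contraNN wN; rewrite /six !inE => /or4P [] ->; rewrite ?orbT.
  by apply: contraNN (six_tN _ wN); rewrite eo // /six !inE => /or4P [] ->; rewrite ?orbT.
rewrite /six !inE => /or4P [|||/or3P [||]] /eqP ->;
  rewrite ?tp ?ty ?tr -/y -/p -/r ?(s1, s2, s3, s4, sp, sr) -/z ?up ?uz ?ur !boolE.
all: by move: (u x) (u (ft2 x)) (u y) => [] [] [].
Qed.

(** On jumps [shift] acts as the involution [slide_vec], so the same correction serves for both
    inclusions. *)
Lemma lag_of_flag_move : lag_of t' = slide_vec (fedge x) (fedge y) i @: lag_of t.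
Proof.
apply/setP => v; apply/imsetP/imsetP => [[u ut ->] | [_ /imsetP [u ut ->] ->]].
  exists (jumps (shift x y i u)); first exact/imset_f/unshift_corner_functions.
  by rewrite jumps_shift // slide_vecK.
by exists (shift x y i u); [exact: shift_corner_functions | rewrite jumps_shift].
Qed.

(** A function invariant under all the maps has zero jumps, so [shift] fixes it and it is also a
    corner function of [t]. *)
Lemma ribbon_graph_flag_move : ribbon_graph t'.
Proof.
split; [exact: flag_moveK | exact: flag_moveN |] => u ut ui.
pose w := [ffun a => u a] : {ffun flag E -> bool}.
have wi j a : w (ft j a) = w a by rewrite !ffunE ui.
have we : even_edges w by apply: (even_of_side _ set0) => a; exact: wi.
have w0 : jumps w = 0 by apply: jumps_eq0 => j a; exact: wi.
have /unshift_corner_functions : w \in corner_functions t'.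
  by apply/corner_functionsP; split=> // a; rewrite !ffunE ut.
have -> : shift x y i w = w.
  by apply/ffunP => a; rewrite /shift w0 ffunE !ffunE !mulr0 !addr0.
by move=> /corner_functionsP [wt _]; apply: (ribbon_conn rt) => // a; have := wt a; rewrite !ffunE.
Qed.

Lemma mem_dm_of_flag_move S :
  (S \in dm_of t') = (S \in dm_of t) (+)
    [&& fedge x \in S, (fedge y \in S) == i & symd S [set fedge x; fedge y] \in dm_of t].
Proof.
rewrite !dm_of_lag //; last exact: ribbon_graph_flag_move.
by rewrite lag_of_flag_move mem_dm_lag_slide //; exact: lagrangian_lag_of.
Qed.

End Moved.

End SecondMove.

Arguments flag_move {E} t x i _.
Arguments flag_moveE {E} [t x i].
Arguments ribbon_graph_flag_move {E} [t x] i.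

(** * The operations on set systems and the four-term relation *)

Lemma mem_slide_ss (E : finType) (a b : E) (Phi : {set {set E}}) S : a != b ->
  (S \in slide_ss a b Phi) =
  (S \in Phi) (+) [&& a \in S, b \notin S & symd S [set a; b] \in Phi].
Proof.
move=> /negPf ab; have ba : (b == a) = false by rewrite eq_sym.
rewrite mem_symd; congr (_ (+) _).
(* Trading [a] for [b] is symmetric difference with [[set a; b]], which turns the sets toggled by
   the slide into a condition on [S] itself. *)
have swap (B : {set E}) : a \notin B -> b \notin B -> symd (B :|: [set a]) [set a; b] = B :|: [set b].
  move=> /negPf aB /negPf bB; apply/setP => e; rewrite !inE.
  have [->|ea] := eqVneq e a; first by rewrite aB ab.
  by have [->|eb] := eqVneq e b; rewrite ?bB ?ba /=; case: (e \in B).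
apply/imsetP/and3P => [[B] | [aS bS SP]].
  rewrite inE => /and3P [aB bB BP] ->; rewrite swap //.
  by rewrite !inE eqxx orbT negb_or bB ba.
have SE : S = S :\ a :|: [set a] by rewrite setUC setD1K.
exists (S :\ a) => //; rewrite inE !in_setD1 eqxx ba /= bS -swap ?in_setD1 ?eqxx ?ba //.
by rewrite -SE.
Qed.

(** Twisting by [[set b]] before and after the slide flips the condition on [b] and commutes with
    symmetric difference. *)
Lemma mem_exch_ss (E : finType) (a b : E) (Phi : {set {set E}}) S : a != b ->
  (S \in exch_ss a b Phi) =
  (S \in Phi) (+) [&& a \in S, b \in S & symd S [set a; b] \in Phi].
Proof.
move=> ab; rewrite /exch_ss mem_twist mem_slide_ss // !mem_twist !mem_symd !inE eqxx (negPf ab).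
rewrite addbT addbF negbK.
have -> : symd (symd S [set b]) [set b] = S.
  by apply/setP => e; rewrite !mem_symd -addbA addbb addbF.
have -> // : symd (symd (symd S [set b]) [set a; b]) [set b] = symd S [set a; b].
by apply/setP => e; rewrite !mem_symd addbAC -(addbA (e \in S)) addbb addbF.
Qed.

Lemma embedded_ribbon_graph (E : finType) (t : flag E -> flag E) :
  is_embedded_graph t -> ribbon_graph t.
Proof.
case=> tK tN tc; split=> // u ut ui z z'.
have /connectP [p pp ->] := tc z z'; elim: p z pp => //= w p IH z /andP [zw /IH <-].
by case/or3P: zw => /eqP ->; rewrite ?ut //; [rewrite (ui false z) | rewrite (ui true z)].
Qed.

Lemma dm_of_slide_eg (E : finType) (t : flag E -> flag E) x :
  ribbon_graph t -> fedge x != fedge (t x) ->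
  dm_of (slide_eg t x) = slide_ss (fedge x) (fedge (t x)) (dm_of t).
Proof.
move=> rt xy; apply/setP => S; rewrite mem_slide_ss //.
by rewrite -[slide_eg t x]/(flag_move t x false) mem_dm_of_flag_move // eqbF_neg.
Qed.

Lemma dm_of_exch_eg (E : finType) (t : flag E -> flag E) x :
  ribbon_graph t -> fedge x != fedge (t x) ->
  dm_of (exch_eg t x) = exch_ss (fedge x) (fedge (t x)) (dm_of t).
Proof.
move=> rt xy; apply/setP => S; rewrite mem_exch_ss //.
by rewrite -[exch_eg t x]/(flag_move t x true) mem_dm_of_flag_move // eqb_id.
Qed.

(* f : function on (isomorphism classes of) binary delta-matroids with values
   in a complex vector space V (complex R with R : realType is C). In the
   resulting embedded-graph relation, the moved end of a after sliding sits at
   the corner {ft2 x, ft0 (t1 x)}, so the second exchange is taken at ft2 x. *)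
Theorem theorem4p4 (R : realType) (V : lmodType (complex R))
  (f : forall E : finType, {set {set E}} -> V)
  (f_iso : forall (E E' : finType) (Phi : {set {set E}}) (Psi : {set {set E'}}),
      binary_dm Phi -> iso_ss Phi Psi -> f E Phi = f E' Psi)
  (f_4T : forall (E : finType) (Phi : {set {set E}}) (a b : E),
      binary_dm Phi -> a != b ->
      f E Phi - f E (exch_ss a b Phi) =
      f E (slide_ss a b Phi) - f E (exch_ss a b (slide_ss a b Phi))) :
  forall (E : finType) (t1 : flag E -> flag E) (x : flag E),
    is_embedded_graph t1 ->
    fedge x != fedge (t1 x) ->
    let g := fun t : flag E -> flag E => f E (dm_of t) in
    g t1 - g (exch_eg t1 x) =
    g (slide_eg t1 x) - g (exch_eg (slide_eg t1 x) (ft2 x)).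
Proof.
move=> E t1 x /embedded_ribbon_graph rt xy /=.
have rs : ribbon_graph (slide_eg t1 x) := ribbon_graph_flag_move false rt xy.
have sx : slide_eg t1 x (ft2 x) = ft0 (t1 x).
  (* In the case of equality the slide is the identity and the required corner is already
     present. *)
  have [pz|pz] := eqVneq (t1 (ft2 x)) (ft0 (t1 x)).
    by rewrite /slide_eg pz eqxx.
  by have [[_ _ _ e] _] := @flag_moveE _ _ _ false rt xy pz; exact: e.
have fx : fedge (ft2 x) = fedge x := fedge_ft true x.
have fs : fedge (slide_eg t1 x (ft2 x)) = fedge (t1 x).
  by rewrite sx; exact: (fedge_ft false).
have eS := dm_of_slide_eg E t1 x rt xy.
have eX := dm_of_exch_eg E t1 x rt xy.
have := dm_of_exch_eg E (slide_eg t1 x) (ft2 x) rs.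
rewrite fs fx eS => /(_ xy) eSX.
rewrite eX eSX; apply: f_4T xy.
by rewrite (dm_of_lag _ _ rt); apply: binary_dm_lag; exact: lagrangian_lag_of.
Qed.
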